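(* Let $Q$ be a bivariate quasi-copula. Then the following two conditions are equivalent. (i) There exists a signed measure $\mu_Q$ defined on the Borel $\sigma$-algebra on $[0,1]^2$ such that $\mu_Q([0,x]\times[0,y])=Q(x,y)$ for all $x,y\in[0,1]$. (ii) There exist a sequence of bivariate copulas $(C_n)_{n\ge 1}$ and a sequence of real numbers $(\gamma_n)_{n\ge1}$ such that (a) the series of functions $\sum_{n=1}^\infty \gamma_n C_n$ converges uniformly on $[0,1]^2$ to $Q$, and (b) the series of induced measures $\sum_{n=1}^\infty \gamma_n\mu_{C_n}$ converges in the total variation norm to some finite signed measure.
   Context: A function $Q\colon[0,1]^2\to[0,1]$ is a (bivariate) quasi-copula if: $Q(x,0)=Q(0,y)=0$ for all $x,y\in[0,1]$; $Q(x,1)=x$ and $Q(1,y)=y$ for all $x,y\in[0,1]$; $Q$ is increasing (nondecreasing) in each variable; and $|Q(x_2,y_2)-Q(x_1,y_1)|\le|x_2-x_1|+|y_2-y_1|$ for all $x_1,y_1,x_2,y_2\in[0,1]$. A function $C\colon[0,1]^2\to[0,1]$ is a (bivariate) copula if it satisfies the first two of these conditions and $C(x_2,y_2)-C(x_1,y_2)-C(x_2,y_1)+C(x_1,y_1)\ge0$ whenever $x_1\le x_2$ and $y_1\le y_2$. Every copula $C$ induces a unique positive measure $\mu_C$ on the Borel $\sigma$-algebra $\mathcal B([0,1]^2)$ with $\mu_C([0,x]\times[0,y])=C(x,y)$ for all $x,y\in[0,1]$. The total variation norm of a finite signed measure $\mu$ with Jordan decomposition $\mu=\mu^+-\mu^-$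 is $\|\mu\|_{TV}=\mu^+([0,1]^2)+\mu^-([0,1]^2)$. *)

(* Defs.v *)
From HB Require Import structures.
From mathcomp Require Import all_boot all_order all_algebra.
From mathcomp Require Import all_classical all_reals all_analysis.

Set Implicit Arguments.
Unset Strict Implicit.
Unset Printing Implicit Defensive.

Import Order.TTheory GRing.Theory Num.Theory.
Import numFieldNormedType.Exports.

Local Open Scope classical_set_scope.
Local Open Scope ring_scope.

(* A function on [0,1]^2 is represented by a total function R -> R -> R of
   which only the values on the unit square are constrained or used. *)

Definition unit_square (R : realType) : set (R * R) := `[0, 1] `*` `[0, 1].

Definition unit_valued (R : realType) (F : R -> R -> R) : Prop :=
  forall x y : R, x \in `[0, 1] -> y \in `[0, 1] -> F x y \in `[0, 1].

Definition grounded (R : realType) (F : R -> R -> R) : Prop :=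
  forall x : R, x \in `[0, 1] -> F x 0 = 0 /\ F 0 x = 0.

Definition uniform_margins (R : realType) (F : R -> R -> R) : Prop :=
  forall x : R, x \in `[0, 1] -> F x 1 = x /\ F 1 x = x.

Definition quasi_copula (R : realType) (Q : R -> R -> R) : Prop :=
  [/\ unit_valued Q, grounded Q, uniform_margins Q,
      (forall x1 x2 y : R, x1 \in `[0, 1] -> x2 \in `[0, 1] -> y \in `[0, 1] ->
         x1 <= x2 -> Q x1 y <= Q x2 y /\ Q y x1 <= Q y x2) &
      (forall x1 y1 x2 y2 : R,
         x1 \in `[0, 1] -> y1 \in `[0, 1] -> x2 \in `[0, 1] -> y2 \in `[0, 1] ->
         `|Q x2 y2 - Q x1 y1| <= `|x2 - x1| + `|y2 - y1|)].

Definition copula (R : realType) (C : R -> R -> R) : Prop :=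
  [/\ unit_valued C, grounded C, uniform_margins C &
      (forall x1 x2 y1 y2 : R,
         x1 \in `[0, 1] -> x2 \in `[0, 1] -> y1 \in `[0, 1] -> y2 \in `[0, 1] ->
         x1 <= x2 -> y1 <= y2 ->
         0 <= C x2 y2 - C x1 y2 - C x2 y1 + C x1 y1)].

(* The type of points of [0,1]^2, with the subspace topology of R * R; it is
   made pointed because the library's generated sigma-algebras require it. *)
Definition square (R : realType) : Type := set_type (@unit_square R).

HB.instance Definition _ (R : realType) :=
  Topological.copy (square R) (set_type (@unit_square R)).

Lemma unit_square0 (R : realType) : (0, 0) \in @unit_square R.
Proof. by rewrite inE; split; rewrite /= in_itv /= lexx ler01. Qed.

HB.instance Definition _ (R : realType) :=
  isPointed.Build (square R) (exist _ (0, 0) (unit_square0 R)).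

Definition borel_square (R : realType) := g_sigma_algebraType (@open (square R)).

Definition box (R : realType) (x y : R) : set (borel_square R) :=
  [set p : square R | (`[0, x] `*` `[0, y]) (set_val p)].

(* Boxes form a generating pi-system containing the whole square, so at most one
   finite measure (or charge) is induced by F: for a copula C, mu_C is the
   finite measure mu with induces C mu. *)
Definition induces (R : realType) (F : R -> R -> R)
    (mu : set (borel_square R) -> \bar R) : Prop :=
  forall x y : R, x \in `[0, 1] -> y \in `[0, 1] -> mu (box x y) = (F x y)%:E.

Section total_variation.
Context d (T : measurableType d) (R : realType).
Implicit Types nu : {charge set T -> \bar R}.

(* The Jordan decomposition does not depend on the Hahn decomposition it is
   read off from, see tv_normE. *)
Definition tv_norm nu : \bar R :=
  let: exist P exN := cid (Hahn_decomposition nu) in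
  charge_variation (svalP (cid exN)) [set: T].

Lemma tv_normE nu P N (nuPN : hahn_decomposition nu P N) :
  tv_norm nu = (jordan_pos nuPN [set: T] + jordan_neg nuPN [set: T])%E.
Proof.
rewrite /tv_norm; case: cid => P' exN; move: (svalP _) => nuPN'.
have [eP eN] := Hahn_decomposition_uniq nuPN' nuPN measurableT.
rewrite /charge_variation /= !jordan_posE !jordan_negE !cjordan_posE.
by rewrite !cjordan_negE /crestr0 !mem_set//= /crestr eP eN.
Qed.

(* The n-th partial sum u 0 + ... + u (n - 1), as a charge. *)
Fixpoint charge_series (u : nat -> {charge set T -> \bar R}) (n : nat) :
    {charge set T -> \bar R} :=
  if n is m.+1 then cadd (charge_series u m) (u m) else czero.

Definition tv_cvg (u : nat -> {charge set T -> \bar R}) nu : Prop :=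
  tv_norm (cadd (u n) (copp nu)) @[n --> \oo] --> 0%E.

End total_variation.

(* Main.v *)
Require Import Defs.
From HB Require Import structures.
From mathcomp Require Import all_boot all_order all_algebra.
From mathcomp Require Import all_classical all_reals all_analysis.
From mathcomp Require Import measurable_realfun ring lra.

(* The implication from (ii) to (i) evaluates the limit charge on boxes. For the
   converse let mu = mu+ - mu- be the Jordan decomposition of mu_Q, let lam be
   the uniform measure on [0,1] and Lam = lam x lam. Since Q is 1-Lipschitz and
   increasing, mu(E x [0,y]) = 0 for all y and all lam-null E, so mu vanishes
   on all Borel subsets of E x [0,1], and the margins of mu+ and mu- are
   absolutely continuous with respect to lam.

   The operator T t = t - t1 x lam - lam x t2 + t([0,1]^2) Lam, where t1 and t2
   are the margins of t, kills margins, is bounded in total variation, and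
   satisfies T mu = mu - Lam. If t is positive with margins at most M lam, then
   T t + 2 M Lam = t + (M lam - t1) x lam + lam x (M lam - t2) + t([0,1]^2) Lam
   is positive with margins 2 M lam, so T t = 2 M (alpha - Lam) for some measure
   alpha induced by a copula.

   Let G > 0 be a weight such that the margins of G mu+ and G mu- are at most
   lam (Radon-Nikodym), and let s_j be the j-th harmonic sum. The slices
   (min(1, s_(j+1) G) - min(1, s_j G)) mu+/- have margins at most lam / (j+1) and
   add up to mu+/-. Applying T to them writes mu - Lam as the sum of the measures
   2 (alpha_j - beta_j) / (j+1), with alpha_j and beta_j induced by copulas; the
   coefficients tend to 0, so the series may be read one copula at a time. *)

Set Implicit Arguments.
Unset Strict Implicit.
Unset Printing Implicit Defensive.

Import Order.TTheory GRing.Theory Num.Theory.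
Import numFieldNormedType.Exports.

Local Open Scope classical_set_scope.
Local Open Scope ring_scope.

(** * The unit square and its Borel sets *)

(** Nearest-point projection of the line onto the unit interval; by [unif01_ray] it is also the
    distribution function of [unif01]. *)
Definition clamp (R : realType) (x : R) : R := Num.max 0 (Num.min x 1).

Lemma clamp_in01 (R : realType) (x : R) : clamp x \in `[0, 1].
Proof.
by rewrite in_itv/= /clamp le_max lexx/= ge_max ler01/= ge_min lexx orbT.
Qed.

Lemma clamp_id (R : realType) (x : R) : x \in `[0, 1] -> clamp x = x.
Proof.
rewrite in_itv/= => /andP[x0 x1].
by rewrite /clamp (min_idPl x1); apply/max_idPr.
Qed.

Lemma clamp_mono (R : realType) : {homo @clamp R : x y / x <= y}.
Proof.
move=> x y xy; rewrite /clamp ge_max le_max lexx/=.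
by rewrite !le_max !le_min !ge_min xy lexx !orbT.
Qed.

Lemma clamp_lipschitz (R : realType) (x y : R) : x <= y ->
  clamp y - clamp x <= y - x.
Proof.
rewrite /clamp => xy.
case: (leP x 1) => ?; case: (leP y 1) => ?; rewrite !maxElt.
all: by repeat case: ifPn => [?|]; rewrite -?leNgt; repeat move=> ?; lra.
Qed.

Lemma clamp_le (R : realType) (x t : R) : 0 <= t -> t < 1 ->
  (clamp x <= t) = (x <= t).
Proof.
move=> t0 t1; rewrite /clamp ge_max t0/= ge_min.
by rewrite [1 <= t]leNgt t1 orbF.
Qed.

Lemma measurable_clamp (R : realType) : measurable_fun [set: R] (@clamp R).
Proof.
apply: measurable_maxr => //.
exact: measurable_minr.
Qed.

(** An open set of the plane is the union of the countably many open rectangles with rational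
    endpoints that it contains. *)
Lemma open_measurable_plane (R : realType) (V : set (R * R)) :
  open V -> measurable V.
Proof.
move=> oV.
pose I (q : rat * rat) : set R := `]ratr q.1, ratr q.2[%classic.
(* Rectangles that leave [V] are replaced by the empty set, so that the union runs over all
   rationals. *)
pose F (a b c d : rat) : set (R * R) :=
  if asbool (I (a, b) `*` I (c, d) `<=` V) then I (a, b) `*` I (c, d) else set0.
have rat_nbhs (x : R) (B : set R) : nbhs x B ->
    exists2 q : rat * rat, I q x & I q `<=` B.
  move=> /nbhs_ballP[e /= e0 eB].
  have [q1 ] : exists q : rat, ratr q \in `]x - e, x[.
    by have [q qI] := @rat_in_itvoo R (x - e) x ltac:(lra); exists q.
  have [q2 ] : exists q : rat, ratr q \in `]x, x + e[.
    by have [q qI] := @rat_in_itvoo R x (x + e) ltac:(lra); exists q.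
  rewrite !in_itv/= => /andP[? ?] /andP[? ?].
  exists (q1, q2); rewrite /I/= ?in_itv/=; first by apply/andP.
  move=> y /=; rewrite in_itv/= => /andP[? ?]; apply: eB.
  by rewrite /ball/= ltr_distlC; apply/andP; split; lra.
have -> : V = \bigcup_a \bigcup_b \bigcup_c \bigcup_d F a b c d.
  apply/seteqP; split => [[x y] Vxy|p [a _ [b _ [c _ [d _]]]]]; last first.
    by rewrite /F; case: asboolP => // qV /qV.
  have /= [[A B] /= [xA yB] ABV] : nbhs (x, y) V by exact: open_nbhs_nbhs.
  have [[a b] abx abA] := rat_nbhs _ _ xA.
  have [[c d] cdy cdB] := rat_nbhs _ _ yB.
  exists a => //; exists b => //; exists c => //; exists d => //.
  rewrite /F asboolT; first by split.
  by move=> [u v] [/abA Au /cdB Bv]; apply: ABV.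
do 4 (apply: bigcupT_measurable_rat => ?).
by rewrite /F; case: asboolP => // _; apply: measurableX; exact: measurable_itv.
Qed.

Definition sqfst (R : realType) (p : borel_square R) : R :=
  (set_val (p : square R)).1.
Definition sqsnd (R : realType) (p : borel_square R) : R :=
  (set_val (p : square R)).2.

Lemma sq_in01 (R : realType) (p : borel_square R) :
  sqfst p \in `[0, 1] /\ sqsnd p \in `[0, 1].
Proof.
by have := set_valP (p : square R); rewrite /unit_square => -[].
Qed.

Lemma clamp_pair_subproof (R : realType) (z : R * R) :
  (clamp z.1, clamp z.2) \in @unit_square R.
Proof. by rewrite inE; split; exact: clamp_in01. Qed.

(** A measurable retraction of the plane onto the square; product measures, which live on [R * R],
    are transported along it. *)
Definition to_sq (R : realType) (z : R * R) : borel_square R :=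
  exist _ (clamp z.1, clamp z.2) (clamp_pair_subproof z).

Lemma to_sqK (R : realType) (p : borel_square R) : to_sq (sqfst p, sqsnd p) = p.
Proof.
have [p1 p2] := sq_in01 p.
apply: val_inj; rewrite /= !clamp_id//; exact/esym/surjective_pairing.
Qed.

(** Open sets of the square are traces of open sets [V] of the plane, and the preimage of such a
    trace is the preimage of [V] under clamping both coordinates. *)
Lemma measurable_to_sq (R : realType) : measurable_fun setT (@to_sq R).
Proof.
apply: (@measurability _ _ _ (borel_square R) setT (@to_sq R) (@open (square R)) erefl).
move=> _ [_ [V oV <-] <-]; rewrite setTI.
rewrite (_ : _ @^-1` _ = (fun z : R * R => (clamp z.1, clamp z.2)) @^-1` V)//.
rewrite -[X in measurable X]setTI.
have : measurable_fun setT (fun z : R * R => (clamp z.1, clamp z.2)).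
  by apply: measurable_fun_pair; apply: measurableT_comp => //;
    exact: measurable_clamp.
by apply => //; exact: open_measurable_plane.
Qed.

Lemma measurable_sqfst (R : realType) : measurable_fun setT (@sqfst R).
Proof.
apply: (measurability _ (RGenOpens.measurableE R)).
move=> _ [_ [a [b ->] <-]]; rewrite setTI; apply: sub_sigma_algebra.
exists (fst @^-1` `]a, b[%classic) => //.
by apply: open_comp; [move=> z _; exact: cvg_fst|exact: interval_open].
Qed.

Lemma measurable_sqsnd (R : realType) : measurable_fun setT (@sqsnd R).
Proof.
apply: (measurability _ (RGenOpens.measurableE R)).
move=> _ [_ [a [b ->] <-]]; rewrite setTI; apply: sub_sigma_algebra.
exists (snd @^-1` `]a, b[%classic) => //.
by apply: open_comp; [move=> z _; exact: cvg_snd|exact: interval_open].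
Qed.

(** The lower bounds [0] hold automatically at points of the square. *)
Lemma boxE (R : realType) (x y : R) :
  box x y = [set p : borel_square R | sqfst p <= x /\ sqsnd p <= y].
Proof.
have itv01 (t u : R) : 0 <= t -> (`[0, u]%classic t) = (t <= u) :> Prop.
  by move=> t0; rewrite /= in_itv/= t0.
apply/seteqP; split => p; have [/itvP p1 /itvP p2] := sq_in01 p.
  by case; rewrite !itv01 ?p1 ?p2.
by case=> p1x p2y; split; rewrite itv01 ?p1 ?p2.
Qed.

Lemma measurable_box (R : realType) (x y : R) : measurable (@box R x y).
Proof.
have -> : @box R x y = (@sqfst R @^-1` `]-oo, x]) `&` (@sqsnd R @^-1` `]-oo, y]).
  by rewrite boxE; apply/seteqP; split => p /=; rewrite !in_itv.
apply: measurableI; rewrite -[X in measurable X]setTI.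
  exact: measurable_sqfst.
exact: measurable_sqsnd.
Qed.

(** * Finite measures on the line *)

Lemma finite_measure_lty d (T : measurableType d) (R : realType)
    (m : {finite_measure set T -> \bar R}) (A : set T) :
  measurable A -> (m A < +oo)%E.
Proof. by move=> mA; rewrite ltey_eq fin_num_measure. Qed.

(* The library's [lebesgue_measure] and [lebesgue_stieltjes_measure] live on a
   copy of R carrying another measurability display. *)
Definition real_measure (R : realType)
  (m : {measure set (measurableTypeR R) -> \bar R}) : set R -> \bar R := m.

HB.instance Definition _ (R : realType)
    (m : {measure set (measurableTypeR R) -> \bar R}) :=
  isMeasure.Build _ R R (real_measure m) (measure0 m) (measure_ge0 m)
    (@measure_semi_sigma_additive _ _ _ m).

Definition leb (R : realType) : {measure set R -> \bar R} :=
  real_measure (@lebesgue_measure R).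

Lemma leb_itv01_lty (R : realType) : (leb R `[0%R, 1%R]%classic < +oo)%E.
Proof. by rewrite /leb /real_measure/= lebesgue_measure_itv/= lte_fin ltr01 -EFinB ltry. Qed.

Definition unif01 (R : realType) : {finite_measure set R -> \bar R} :=
  mfrestr (measurable_itv `[0%R, 1%R]) (leb_itv01_lty R).

Lemma unif01_ray (R : realType) (x : R) :
  unif01 R `]-oo, x]%classic = (clamp x)%:E.
Proof.
rewrite /= /mfrestr /mrestr /leb /real_measure.
have [x0|x0] := ltP x 0.
  rewrite (_ : _ `&` _ = set0) ?measure0; last first.
    apply/seteqP; split => // y [] /=; rewrite !in_itv/= => yx /andP[y0 _].
    by move: (le_lt_trans (le_trans y0 yx) x0); rewrite ltxx.
  by rewrite /clamp; congr EFin; apply/esym/max_idPl; rewrite ge_min (ltW x0).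
have /itvP c01 := clamp_in01 x.
rewrite (_ : _ `&` _ = `[0, clamp x]%classic); last first.
  apply/seteqP; split => y /=; rewrite !in_itv/=.
    by move=> [yx /andP[y0 y1]]; rewrite y0 /clamp le_max le_min yx y1 orbT.
  move=> /andP[->]; rewrite /clamp le_max => /orP[y0|].
    by rewrite (le_trans y0 x0) (le_trans y0 ler01).
  by rewrite le_min => /andP[-> ->].
rewrite /= lebesgue_measure_itv/= lte_fin lt_neqAle c01 andbT.
by case: eqVneq => [<-|] //=; rewrite EFinN sube0.
Qed.

Lemma finite_measure_ocitv (R : realType) (m : {finite_measure set R -> \bar R})
    (a b : R) : a <= b ->
  m `]a, b]%classic = (m `]-oo, b]%classic - m `]-oo, a]%classic)%E.
Proof.
move=> ab.
rewrite (_ : `]a, b]%classic = `]-oo, b] `\` `]-oo, a]); last first.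
  apply/seteqP; split => y /=; rewrite !in_itv/=.
    by move=> /andP[ay yb]; split => //; apply/negP; rewrite -ltNge.
  by move=> [yb /negP]; rewrite -ltNge => ->.
rewrite measureD//; last exact: finite_measure_lty.
congr (_ - m _)%E; apply/seteqP; split => [y []//|y] /=; rewrite !in_itv/= => ya.
by split => //; exact: le_trans ab.
Qed.

(** Half-open intervals form a generating pi-system, and those from [- n] to [n] exhaust the line
    with finite measure. *)
Lemma measure_unique_ocitv (R : realType) (m1 m2 : {measure set R -> \bar R}) :
  (forall a b : R, a <= b ->
    m1 `]a, b]%classic = m2 `]a, b]%classic /\ (m1 `]a, b]%classic < +oo)%E) ->
  forall A, measurable A -> m1 A = m2 A.
Proof.
move=> m12; apply: (measure_unique (@ocitv R)
    (fun n => `]- n%:R, n%:R]%classic)) => //.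
- exact: ocitvI.
- by move=> n; exact: is_ocitv.
- exact: bigcup_itvT.
- move=> _ [[a b] _ <-] /=; have [ab|ba] := leP a b; first by case: (m12 _ _ ab).
  by rewrite set_itv_ge ?measure0// bnd_simp -leNgt ltW.
- by move=> n; apply: (m12 _ _ _).2; rewrite ge0_cp.
Qed.

Lemma finite_measure_unique_ray (R : realType)
    (m1 m2 : {finite_measure set R -> \bar R}) :
  (forall x : R, m1 `]-oo, x]%classic = m2 `]-oo, x]%classic) ->
  forall A, measurable A -> m1 A = m2 A.
Proof.
move=> m12; apply: measure_unique_ocitv => a b ab.
split; last exact: finite_measure_lty.
apply: etrans (finite_measure_ocitv m1 ab) _; rewrite !m12.
exact/esym/finite_measure_ocitv.
Qed.

(** Being increasing and continuous, [g] defines a Lebesgue-Stieltjes measure [L]. The measures [m2]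
    and [m1 + L] agree on half-open intervals, hence on all Borel sets, and [L] is positive. *)
Lemma le_finite_measure_ray (R : realType) (g : R -> R)
    (m1 m2 : {finite_measure set R -> \bar R}) :
  (forall x y : R, x <= y -> 0 <= g y - g x <= y - x) ->
  (forall x : R, m2 `]-oo, x]%classic = (m1 `]-oo, x]%classic + (g x)%:E)%E) ->
  forall A, measurable A -> (m1 A <= m2 A)%E.
Proof.
move=> gP m12.
have gnd : nondecreasing g by move=> x y /gP /andP[]; rewrite subr_ge0.
have grc : right_continuous g.
  apply: right_continuousW => x; apply/cvgrPdist_le => /= e e0.
  near=> y; apply: (@le_trans _ _ `|x - y|).
    have [xy|/ltW yx] := leP x y; have /andP[h1 h2] := gP _ _ ltac:(eassumption).
      by rewrite distrC [leRHS]distrC !ger0_norm ?subr_ge0//; lra.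
    by rewrite !ger0_norm ?subr_ge0//; lra.
  by near: y; apply: cvgr_dist_le.
pose gc : cumulative R R := HB.pack g (isCumulative.Build R _ R g gnd grc).
pose L : {measure set R -> \bar R} := real_measure (lebesgue_stieltjes_measure gc).
have LE a b : a <= b -> L `]a, b]%classic = (g b - g a)%:E.
  move=> ab; rewrite /L/= /real_measure /lebesgue_stieltjes_measure.
  rewrite /measure_extension measurable_mu_extE/=; last exact: is_ocitv.
  by rewrite wlength_itv_bnd.
have m2E A : measurable A -> m2 A = measure_add m1 L A.
  apply: measure_unique_ocitv => a b ab; split; last first.
    exact: finite_measure_lty.
  apply: etrans (finite_measure_ocitv m2 ab) _.
  apply: etrans (esym (measure_addE _ _ _)).
  apply: etrans _ (esym (congr2 adde (finite_measure_ocitv m1 ab) (LE _ _ ab))).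
  rewrite !m12.
  have aux (u v : \bar R) (c e : R) : u \is a fin_num -> v \is a fin_num ->
      (v + e%:E - (u + c%:E) = v - u + (e - c)%:E)%E.
    by case: u v => [u||] [v||]// _ _; congr EFin; ring.
  by apply: aux; exact: fin_num_measure.
by move=> A mA; rewrite m2E// measure_addE leeDl.
Unshelve. all: by end_near. Qed.

(** * Masses, push-forwards and products *)

HB.instance Definition _ (R : realType) :=
  isMeasurableFun.Build _ _ _ _ (@sqfst R) (@measurable_sqfst R).
HB.instance Definition _ (R : realType) :=
  isMeasurableFun.Build _ _ _ _ (@sqsnd R) (@measurable_sqsnd R).
HB.instance Definition _ (R : realType) :=
  isMeasurableFun.Build _ _ _ _ (@to_sq R) (@measurable_to_sq R).

Section finite_measures.
Context d (T : measurableType d) (R : realType).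
Implicit Types m : {finite_measure set T -> \bar R}.

(** Real values let identities between finite measures be settled by ring arithmetic. *)
Definition mass m (A : set T) : R := fine (m A).

Lemma massE m A : measurable A -> m A = (mass m A)%:E.
Proof. by move=> mA; rewrite /mass fineK ?fin_num_measure. Qed.

Lemma mass_ge0 m A : 0 <= mass m A.
Proof. exact: fine_ge0. Qed.

Lemma le_mass m A B : measurable A -> measurable B -> A `<=` B ->
  mass m A <= mass m B.
Proof. by move=> mA mB AB; rewrite -lee_fin -!massE// le_measure// inE. Qed.

(** Restricting to the whole space changes no value and supplies the finite-measure structure. *)
Definition finite_of (mu : {measure set T -> \bar R})
  (muT : (mu setT < +oo)%E) : {finite_measure set T -> \bar R} :=
  mfrestr measurableT muT.

Lemma finite_ofE (mu : {measure set T -> \bar R}) (muT : (mu setT < +oo)%E) A :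
  finite_of muT A = mu A.
Proof. by rewrite /= /mfrestr /mrestr setIT. Qed.

Lemma finite_add_lty m1 m2 : (measure_add m1 m2 setT < +oo)%E.
Proof. by rewrite measure_addE lte_add_pinfty// finite_measure_lty. Qed.

Definition finite_add m1 m2 : {finite_measure set T -> \bar R} :=
  finite_of (finite_add_lty m1 m2).

Lemma mass_add m1 m2 A : measurable A ->
  mass (finite_add m1 m2) A = mass m1 A + mass m2 A.
Proof.
move=> mA; rewrite -fineD ?fin_num_measure// -measure_addE.
by congr fine; exact: finite_ofE.
Qed.

Definition finite_scale (r : {nonneg R}) m : {finite_measure set T -> \bar R} :=
  mscale r m.

Lemma mass_scale r m A : measurable A -> mass (finite_scale r m) A = r%:num * mass m A.
Proof.
by move=> mA; rewrite {1}/mass /= /mscale fineM// fin_num_measure.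
Qed.

(** The pair [setT], [set0] is a Hahn decomposition of a nonnegative charge, whose positive Jordan
    part is then the charge itself. *)
Lemma finite_measure_of_charge (nu : {charge set T -> \bar R}) :
  (forall A, measurable A -> (0 <= nu A)%E) ->
  exists m : {finite_measure set T -> \bar R}, forall A, measurable A -> m A = nu A.
Proof.
move=> nu0.
have nuP : hahn_decomposition nu setT set0.
  split; [by split=> // A mA _; exact: nu0| |by rewrite setU0|by rewrite setI0].
  by split => // A _; rewrite subset0 => ->; rewrite charge0.
exists (jordan_pos nuP) => A mA.
apply: etrans (jordan_posE nuP A) _.
by rewrite cjordan_posE /crestr0 mem_set// /crestr setIT.
Qed.

Lemma finite_measure_sub m1 m2 :
  (forall A, measurable A -> mass m1 A <= mass m2 A) ->
  exists m, forall A, measurable A -> mass m2 A = mass m1 A + mass m A.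
Proof.
move=> m12.
have [|m mE] := @finite_measure_of_charge
    (cadd (charge_of_finite_measure m2) (copp (charge_of_finite_measure m1))).
  move=> A mA; rewrite [leRHS](_ : _ = m2 A - m1 A)%E//.
  by rewrite !massE// -EFinB lee_fin subr_ge0 m12.
exists m => A mA; have : (m A = m2 A - m1 A)%E := mE A mA.
rewrite !massE// -EFinB => -[->].
by rewrite addrC subrK.
Qed.

End finite_measures.

Section push.
Context d1 d2 (T1 : measurableType d1) (T2 : measurableType d2) (R : realType).
Implicit Types m : {finite_measure set T1 -> \bar R}.

Definition push_measure (f : {mfun T1 >-> T2}) m : {measure set T2 -> \bar R}.
Proof.
unshelve refine (pushforward m f : {measure set T2 -> \bar R}).
exact: measurable_funP.
Defined.

Lemma finite_push_lty (f : {mfun T1 >-> T2}) m : (push_measure f m setT < +oo)%E.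
Proof. by rewrite /= /pushforward preimage_setT finite_measure_lty. Qed.

Definition finite_push (f : {mfun T1 >-> T2}) m :
  {finite_measure set T2 -> \bar R} := finite_of (finite_push_lty f m).

Lemma finite_pushE f m A : finite_push f m A = m (f @^-1` A).
Proof. by rewrite finite_ofE. Qed.

Lemma mass_push f m A : mass (finite_push f m) A = mass m (f @^-1` A).
Proof. by rewrite /mass finite_pushE. Qed.

Lemma measurable_preimage (f : {mfun T1 >-> T2}) (A : set T2) :
  measurable A -> measurable (f @^-1` A).
Proof. by move=> mA; rewrite -[X in measurable X]setTI; exact: measurable_funP. Qed.

End push.

Section product.
Context (R : realType).
Implicit Types a b : {finite_measure set R -> \bar R}.

Lemma finite_prod_lty a b : ((a \x b) setT < +oo)%E.
Proof.
by rewrite -setXTT product_measure1E// lte_mul_pinfty// ?finite_measure_lty//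
  ge0_fin_numE// finite_measure_lty.
Qed.

(** Mass of the product outside the square is moved to its boundary; nothing moves when both factors
    are carried by the unit interval. *)
Definition sq_prod a b : {finite_measure set (borel_square R) -> \bar R} :=
  finite_push (@to_sq R) (finite_of (finite_prod_lty a b)).

Lemma sq_prodE a b A : sq_prod a b A = (a \x b)%E (@to_sq R @^-1` A).
Proof. by rewrite finite_pushE finite_ofE. Qed.

Lemma mass_sq_prod_box a b x y :
  mass (sq_prod a b) (box x y) =
  mass a [set t | clamp t <= x] * mass b [set t | clamp t <= y].
Proof.
have mc z : measurable [set t : R | clamp t <= z].
  rewrite (_ : [set t | _] = @clamp R @^-1` `]-oo, z]); last first.
    by apply/seteqP; split => t /=; rewrite in_itv.
  by rewrite -[X in measurable X]setTI; exact: measurable_clamp.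
rewrite /mass sq_prodE boxE (_ : _ @^-1` _ =
  [set t : R | clamp t <= x] `*` [set t : R | clamp t <= y])//.
by rewrite product_measure1E// fineM// fin_num_measure.
Qed.

Lemma mass_sq_prodT a b : mass (sq_prod a b) setT = mass a setT * mass b setT.
Proof.
rewrite /mass sq_prodE preimage_setT -setXTT product_measure1E//.
by rewrite fineM// fin_num_measure.
Qed.

(** Both sides come from measures on the plane that agree on rectangles, so uniqueness of the
    product measure applies. The next three lemmas follow the same pattern. *)
Lemma mass_sq_prodDl a a1 a2 b :
  (forall A, measurable A -> mass a A = mass a1 A + mass a2 A) ->
  forall A, measurable A ->
    mass (sq_prod a b) A = mass (sq_prod a1 b) A + mass (sq_prod a2 b) A.
Proof.
move=> aE A mA; apply: EFin_inj; rewrite EFinD -!massE//.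
rewrite !sq_prodE -measure_addE; apply: product_measure_unique; last first.
  exact: measurable_preimage.
move=> B C mB mC; apply: etrans (measure_addE _ _ _) _.
have h : (a1 B * b C + a2 B * b C)%E = (a B * b C)%E.
  by rewrite !massE// -!EFinM -EFinD aE// mulrDl.
apply: etrans h; exact: (congr2 (fun u v => u + v)%E
  (product_measure1E a1 b mB mC) (product_measure1E a2 b mB mC)).
Qed.

Lemma mass_sq_prodDr a b b1 b2 :
  (forall A, measurable A -> mass b A = mass b1 A + mass b2 A) ->
  forall A, measurable A ->
    mass (sq_prod a b) A = mass (sq_prod a b1) A + mass (sq_prod a b2) A.
Proof.
move=> bE A mA; apply: EFin_inj; rewrite EFinD -!massE//.
rewrite !sq_prodE -measure_addE; apply: product_measure_unique; last first.
  exact: measurable_preimage.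
move=> B C mB mC; apply: etrans (measure_addE _ _ _) _.
have h : (a B * b1 C + a B * b2 C)%E = (a B * b C)%E.
  by rewrite !massE// -!EFinM -EFinD bE// mulrDr.
apply: etrans h; exact: (congr2 (fun u v => u + v)%E
  (product_measure1E a b1 mB mC) (product_measure1E a b2 mB mC)).
Qed.

Lemma mass_sq_prodZl r a b A : measurable A ->
  mass (sq_prod (finite_scale r a) b) A = r%:num * mass (sq_prod a b) A.
Proof.
move=> mA; transitivity (fine (r%:num%:E * sq_prod a b A)%E); last first.
  by rewrite fineM// fin_num_measure.
rewrite /mass !sq_prodE; congr fine.
apply: (product_measure_unique (m' := mscale r (a \x b)%E)); last first.
  exact: measurable_preimage.
move=> B C mB mC.
have h : (r%:num%:E * (a B * b C) = r%:num%:E * a B * b C)%E by rewrite muleA.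
apply: etrans h.
exact: (congr1 (fun u => r%:num%:E * u)%E (product_measure1E a b mB mC)).
Qed.

Lemma mass_sq_prodZr r a b A : measurable A ->
  mass (sq_prod a (finite_scale r b)) A = r%:num * mass (sq_prod a b) A.
Proof.
move=> mA; transitivity (fine (r%:num%:E * sq_prod a b A)%E); last first.
  by rewrite fineM// fin_num_measure.
rewrite /mass !sq_prodE; congr fine.
apply: (product_measure_unique (m' := mscale r (a \x b)%E)); last first.
  exact: measurable_preimage.
move=> B C mB mC.
have h : (r%:num%:E * (a B * b C) = a B * (r%:num%:E * b C))%E by rewrite muleCA.
apply: etrans h.
exact: (congr1 (fun u => r%:num%:E * u)%E (product_measure1E a b mB mC)).
Qed.

End product.

(** * Copulas and measures with uniform margins *)

Lemma mass_setD d (T : measurableType d) (R : realType)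
    (m : {finite_measure set T -> \bar R}) (A B : set T) :
  measurable A -> measurable B -> A `<=` B ->
  mass m (B `\` A) = mass m B - mass m A.
Proof.
move=> mA mB AB; rewrite /mass measureD//; last exact: finite_measure_lty.
by rewrite (setIidr AB) fineB// fin_num_measure.
Qed.

Lemma mass0 d (T : measurableType d) (R : realType)
    (m : {finite_measure set T -> \bar R}) : mass m set0 = 0.
Proof. by rewrite /mass measure0. Qed.

Lemma box_subset (R : realType) (x1 x2 y1 y2 : R) : x1 <= x2 -> y1 <= y2 ->
  box x1 y1 `<=` box x2 y2.
Proof.
rewrite !boxE => x12 y12 p [/= px py].
by split; [exact: le_trans px x12|exact: le_trans py y12].
Qed.

Lemma box11 (R : realType) : box 1 1 = [set: borel_square R].
Proof.
rewrite boxE; apply/seteqP; split => // p _ /=.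
by have [/itvP p1 /itvP p2] := sq_in01 p; rewrite p1 p2.
Qed.

(** Bounds and groundedness follow by comparing a box with the margins. The volume of a rectangle is
    a difference of masses of two nested differences of boxes, hence nonnegative. *)
Lemma copula_of_measure (R : realType)
    (m : {finite_measure set (borel_square R) -> \bar R}) :
  (forall x, x \in `[0, 1] -> mass m (box x 1) = x /\ mass m (box 1 x) = x) ->
  copula (fun x y => mass m (box x y)).
Proof.
move=> mP.
have m0 : (0 : R) \in `[0, 1] by rewrite in_itv/= lexx ler01.
have mle := @le_mass _ _ _ m _ _ (measurable_box _ _) (measurable_box _ _)
  (box_subset _ _).
split.
- move=> x y /[dup] x01 /itvP hx /itvP hy; rewrite in_itv/= mass_ge0/=.
  apply: (@le_trans _ _ x); last by rewrite hx.
  by rewrite -[leRHS](mP x x01).1 mle// hy.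
- move=> x /itvP hx; split; apply/eqP; rewrite eq_le mass_ge0 andbT.
    by rewrite -[leRHS](mP 0 m0).2 mle// hx.
  by rewrite -[leRHS](mP 0 m0).1 mle// hx.
- by move=> x /mP.
- move=> x1 x2 y1 y2 _ _ _ _ x12 y12.
  have -> : mass m (box x2 y2) - mass m (box x1 y2) - mass m (box x2 y1) +
      mass m (box x1 y1) =
      mass m (box x2 y2 `\` box x1 y2) - mass m (box x2 y1 `\` box x1 y1).
    by rewrite !mass_setD//; try exact: measurable_box;
      [ring|exact: box_subset|exact: box_subset].
  rewrite subr_ge0; apply: le_mass; try by apply: measurableD; exact: measurable_box.
  rewrite !boxE => p /= [[px py] npx].
  split; first by split => //; exact: le_trans py y12.
  by move=> [px1 _]; exact: npx.
Qed.

Lemma clamp_le0 (R : realType) (x : R) : x <= 0 -> clamp x = 0.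
Proof. by move=> x0; apply/max_idPl; rewrite ge_min x0. Qed.

Lemma mass_unif01_ray (R : realType) (x : R) :
  mass (unif01 R) `]-oo, x] = clamp x.
Proof. by rewrite /mass unif01_ray. Qed.

(** Extends facts about corners in the unit square to all real corners. *)
Lemma box_clamp (R : realType) (x y : R) :
  box x y = if (0 <= x) && (0 <= y) then box (clamp x) (clamp y) else set0.
Proof.
have le_clampP (t u : R) : 0 <= t <= 1 -> 0 <= u -> (t <= clamp u) = (t <= u).
  by move=> /andP[t0 t1] u0; rewrite /clamp le_max le_min t1 andbT;
    case: (leP t u) => tu; rewrite ?orbT// orbF; apply/negbTE; rewrite -ltNge; lra.
rewrite !boxE; apply/seteqP; split => p /=; have [p1 p2] := sq_in01 p.
  move=> [px py]; rewrite (le_trans _ px) ?(itvP p1)// (le_trans _ py) ?(itvP p2)//=.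
  by rewrite !le_clampP// ?(le_trans _ px) ?(le_trans _ py) ?(itvP p1) ?(itvP p2).
case: ifPn => // /andP[x0 y0] /=.
by rewrite !le_clampP// ?(itvP p1) ?(itvP p2).
Qed.

Lemma sqfst_ray (R : realType) (x : R) : @sqfst R @^-1` `]-oo, x] = box x 1.
Proof.
rewrite boxE; apply/seteqP; split => p /=; rewrite in_itv//=.
  by have [_ /itvP ->] := sq_in01 p.
by case.
Qed.

Lemma sqsnd_ray (R : realType) (x : R) : @sqsnd R @^-1` `]-oo, x] = box 1 x.
Proof.
rewrite boxE; apply/seteqP; split => p /=; rewrite in_itv//=.
  by have [/itvP -> _] := sq_in01 p.
by case.
Qed.

(** * Margins, centering, and copulas from measures with bounded margins *)

Section centered.
Context (R : realType).
Notation fmS := {finite_measure set (borel_square R) -> \bar R}.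
Implicit Types t m : fmS.

(** The measure of the independence copula, see [mass_unif_sq_box]. *)
Definition unif_sq : fmS := sq_prod (unif01 R) (unif01 R).

Definition marg1 t : {finite_measure set R -> \bar R} := finite_push (@sqfst R) t.
Definition marg2 t : {finite_measure set R -> \bar R} := finite_push (@sqsnd R) t.

(* The projection onto the measures with null margins. *)
Definition centered t (A : set (borel_square R)) : R :=
  mass t A - mass (sq_prod (marg1 t) (unif01 R)) A
  - mass (sq_prod (unif01 R) (marg2 t)) A + mass t setT * mass unif_sq A.

Lemma mass_marg1 t A : mass (marg1 t) A = mass t (@sqfst R @^-1` A).
Proof. exact: mass_push. Qed.

Lemma mass_marg2 t A : mass (marg2 t) A = mass t (@sqsnd R @^-1` A).
Proof. exact: mass_push. Qed.

Lemma centeredD t t1 t2 :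
  (forall A, measurable A -> mass t A = mass t1 A + mass t2 A) ->
  forall A, measurable A -> centered t A = centered t1 A + centered t2 A.
Proof.
move=> tE A mA; rewrite /centered.
rewrite (@mass_sq_prodDl _ (marg1 t) (marg1 t1) (marg1 t2))//; last first.
  by move=> B mB; rewrite !mass_marg1 tE//; exact: measurable_preimage.
rewrite (@mass_sq_prodDr _ _ (marg2 t) (marg2 t1) (marg2 t2))//; last first.
  by move=> B mB; rewrite !mass_marg2 tE//; exact: measurable_preimage.
by rewrite !tE//; ring.
Qed.

(** At [x = 1] the clamped set is the whole line, whereas the ray could miss mass beyond [1]. *)
Lemma mass_clamp_ray (a : {finite_measure set R -> \bar R}) x : x \in `[0, 1] ->
  mass a [set t | clamp t <= x] = if x < 1 then mass a `]-oo, x] else mass a setT.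
Proof.
move=> /itvP hx; case: ltP => x1; congr (mass a); apply/seteqP; split => t //=.
- by rewrite clamp_le ?hx// in_itv.
- by rewrite clamp_le ?hx// in_itv.
- by move=> _; have /itvP ct := clamp_in01 t; rewrite (le_trans _ x1)// ct.
Qed.

Lemma mass_unif01T : mass (unif01 R) setT = 1.
Proof.
by rewrite /mass /= /mfrestr /mrestr setTI /leb /real_measure/=
  lebesgue_measure_itv/= lte_fin ltr01 -EFinB subr0.
Qed.

Lemma mass_unif01_clamp x : x \in `[0, 1] ->
  mass (unif01 R) [set t | clamp t <= x] = x.
Proof.
move=> x01; rewrite mass_clamp_ray//; case: ltP => x1.
  by rewrite /mass unif01_ray clamp_id.
by rewrite mass_unif01T; apply/le_anti; rewrite x1 (itvP x01).
Qed.

Lemma mass_marg1_clamp t x : mass (marg1 t) [set u | clamp u <= x] = mass t (box x 1).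
Proof.
rewrite mass_marg1; congr (mass t); rewrite boxE; apply/seteqP.
by split => p /=; have [p1 /itvP p2] := sq_in01 p; rewrite clamp_id// p2//; case.
Qed.

Lemma mass_marg2_clamp t x : mass (marg2 t) [set u | clamp u <= x] = mass t (box 1 x).
Proof.
rewrite mass_marg2; congr (mass t); rewrite boxE; apply/seteqP.
by split => p /=; have [/itvP p1 p2] := sq_in01 p; rewrite clamp_id// p1//; case.
Qed.

Lemma mass_marg1T t : mass (marg1 t) setT = mass t setT.
Proof. by rewrite mass_marg1 preimage_setT. Qed.

Lemma mass_marg2T t : mass (marg2 t) setT = mass t setT.
Proof. by rewrite mass_marg2 preimage_setT. Qed.

Lemma mass_unif_sq_box x y : x \in `[0, 1] -> y \in `[0, 1] ->
  mass unif_sq (box x y) = x * y.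
Proof. by move=> x01 y01; rewrite mass_sq_prod_box !mass_unif01_clamp. Qed.

Lemma one01 : (1 : R) \in `[0, 1].
Proof. by rewrite in_itv/= ler01 lexx. Qed.

(** On these boxes the four terms of [centered] cancel in pairs: [t] against one of the product
    terms, the other product term against the multiple of [unif_sq]. *)
Lemma centered_box1 t x : x \in `[0, 1] ->
  centered t (box x 1) = 0 /\ centered t (box 1 x) = 0.
Proof.
move=> x01; have l1 := one01; rewrite /centered !mass_unif_sq_box//.
rewrite !mass_sq_prod_box !mass_marg1_clamp !mass_marg2_clamp.
by rewrite !mass_unif01_clamp// box11; split; ring.
Qed.

(** Each of the four terms lies between [0] and [mass t setT], and two of them carry each sign. *)
Lemma centered_bound t A : measurable A -> `|centered t A| <= 2 * mass t setT.
Proof.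
move=> mA.
have leT (m : fmS) (s : R) : mass m setT = s -> 0 <= mass m A <= s.
  by move=> <-; rewrite mass_ge0 le_mass.
have aux (a b c e s : R) : 0 <= a <= s -> 0 <= b <= s -> 0 <= c <= s ->
    0 <= e <= s -> `|a - b - c + e| <= 2 * s.
  move=> /andP[? ?] /andP[? ?] /andP[? ?] /andP[? ?].
  by rewrite ler_norml; apply/andP; split; lra.
rewrite /centered; apply: aux; first exact: leT.
- by apply: leT; rewrite mass_sq_prodT mass_unif01T mass_marg1T mulr1.
- by apply: leT; rewrite mass_sq_prodT mass_unif01T mass_marg2T mul1r.
- have /andP[u0 u1] := leT unif_sq _ erefl.
  rewrite mulr_ge0 ?mass_ge0//= -[leRHS]mulr1 ler_wpM2l ?mass_ge0//.
  by rewrite (le_trans u1)// mass_sq_prodT mass_unif01T mulr1.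
Qed.

(* Adding [M unif01 - marg1 t] times [unif01] and [unif01] times
   [M unif01 - marg2 t] to [t] gives a positive measure whose margins are
   uniform, up to a factor. *)
Lemma centered_copula t (M : R) : 0 < M ->
  (forall A, measurable A -> mass (marg1 t) A <= M * mass (unif01 R) A) ->
  (forall A, measurable A -> mass (marg2 t) A <= M * mass (unif01 R) A) ->
  exists alpha : fmS, copula (fun x y => mass alpha (box x y)) /\
    forall A, measurable A ->
      2 * M * mass alpha A = centered t A + 2 * M * mass unif_sq A.
Proof.
move=> M0 t1 t2.
pose Mn : {nonneg R} := NngNum (ltW M0).
have [A mA|d1 d1E] := @finite_measure_sub _ _ R (marg1 t) (finite_scale Mn (unif01 R)).
  by rewrite mass_scale//; exact: t1.
have [A mA|d2 d2E] := @finite_measure_sub _ _ R (marg2 t) (finite_scale Mn (unif01 R)).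
  by rewrite mass_scale//; exact: t2.
pose tT : {nonneg R} := NngNum (mass_ge0 t setT).
have c0 : 0 <= (2 * M)^-1 by rewrite invr_ge0 mulr_ge0// ltW.
pose alpha : fmS := finite_scale (NngNum c0)
  (finite_add (finite_add t (finite_scale tT unif_sq))
     (finite_add (sq_prod d1 (unif01 R)) (sq_prod (unif01 R) d2))).
have alphaE A : measurable A ->
    2 * M * mass alpha A = centered t A + 2 * M * mass unif_sq A.
  move=> mA; rewrite mass_scale// mulrA mulfV ?mul1r; last first.
    by rewrite mulf_neq0// gt_eqF.
  rewrite !mass_add// mass_scale//=.
  have := mass_sq_prodDl (unif01 R) d1E mA; rewrite mass_sq_prodZl//= => h1.
  have := mass_sq_prodDr (unif01 R) d2E mA; rewrite mass_sq_prodZr//= => h2.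
  rewrite -/unif_sq in h1 h2.
  rewrite /centered; lra.
exists alpha; split => //.
(* Since [centered t] vanishes on boxes with a side [1], [alpha] has the margins of [unif_sq]. *)
apply: copula_of_measure => x x01; have [cx1 cx2] := centered_box1 t x01.
have M2 : 2 * M != 0 by rewrite mulf_neq0// gt_eqF.
split; apply: (mulfI M2); rewrite alphaE; try exact: measurable_box.
  by rewrite cx1 add0r mass_unif_sq_box// ?one01// mulr1.
by rewrite cx2 add0r mass_unif_sq_box// ?one01// mul1r.
Qed.

Lemma copula_unif_sq : copula (fun x y => mass unif_sq (box x y)).
Proof.
apply: copula_of_measure => x x01.
by rewrite !mass_unif_sq_box ?one01// mulr1 mul1r.
Qed.

(** Both margins of [mp - mn] equal [unif01]: two copies of [unif_sq] are subtracted, and the total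
    mass [1] gives one back. *)
Lemma centered_jordan (mp mn : fmS) :
  (forall x, x \in `[0, 1] -> mass mp (box x 1) - mass mn (box x 1) = x) ->
  (forall x, x \in `[0, 1] -> mass mp (box 1 x) - mass mn (box 1 x) = x) ->
  forall A, measurable A ->
    centered mp A - centered mn A = mass mp A - mass mn A - mass unif_sq A.
Proof.
move=> m1 m2.
have m1E B : measurable B -> mass (marg1 mp) B = mass (marg1 mn) B + mass (unif01 R) B.
  move=> mB; rewrite -mass_add//; congr fine; move: B mB.
  apply: finite_measure_unique_ray => x.
  rewrite 2?massE// mass_add// mass_unif01_ray !mass_marg1 !sqfst_ray box_clamp.
  rewrite ler01 andbT; case: ifPn => x0; last first.
    by rewrite !mass0 add0r clamp_le0// ltW// ltNge.
  rewrite (clamp_id one01); congr EFin; have := m1 _ (clamp_in01 x); lra.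
have m2E B : measurable B -> mass (marg2 mp) B = mass (marg2 mn) B + mass (unif01 R) B.
  move=> mB; rewrite -mass_add//; congr fine; move: B mB.
  apply: finite_measure_unique_ray => x.
  rewrite 2?massE// mass_add// mass_unif01_ray !mass_marg2 !sqsnd_ray box_clamp.
  rewrite ler01 /=; case: ifPn => x0; last first.
    by rewrite !mass0 add0r clamp_le0// ltW// ltNge.
  rewrite (clamp_id one01); congr EFin; have := m2 _ (clamp_in01 x); lra.
move=> A mA; rewrite /centered.
rewrite (mass_sq_prodDl (unif01 R) m1E mA) (mass_sq_prodDr (unif01 R) m2E mA).
have := m1 _ one01; rewrite box11 -/unif_sq => /eqP; rewrite subr_eq => /eqP ->.
ring.
Qed.

End centered.

(** * Margins of a signed measure with a Lipschitz distribution function *)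

Section restriction.
Context d (T : measurableType d) (R : realType).
Implicit Types m : {finite_measure set T -> \bar R}.

Definition finite_restr m (D : set T) (mD : measurable D) :
  {finite_measure set T -> \bar R} := mfrestr mD (finite_measure_lty m mD).

Lemma mass_restr m D (mD : measurable D) A :
  mass (finite_restr m mD) A = mass m (A `&` D).
Proof. by []. Qed.

End restriction.

(** Both [q] and [clamp - q] are increasing and 1-Lipschitz, so [le_finite_measure_ray] gives
    [b <= a <= b + unif01] on Borel sets; the bounds coincide on null sets. *)
Lemma eq_mass_null (R : realType) (q : R -> R)
    (a b : {finite_measure set R -> \bar R}) :
  (forall x y : R, x <= y -> 0 <= q y - q x <= clamp y - clamp x) ->
  (forall x : R, mass a `]-oo, x] - mass b `]-oo, x] = q x) ->
  forall E, measurable E -> mass (unif01 R) E = 0 -> mass a E = mass b E.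
Proof.
move=> qP ab E mE E0; apply/le_anti/andP; split.
  rewrite -[leRHS]addr0 -E0 -mass_add// -lee_fin -!massE//.
  apply: (@le_finite_measure_ray _ (fun x => clamp x - q x)) => //.
    move=> x y xy; have /andP[? ?] := qP _ _ xy; have ? := clamp_lipschitz xy.
    by apply/andP; split; lra.
  move=> x; rewrite !massE// mass_add// mass_unif01_ray -EFinD -ab.
  by congr EFin; ring.
rewrite -lee_fin -!massE//; apply: (@le_finite_measure_ray _ q) => //.
  move=> x y xy; have /andP[-> h] := qP _ _ xy.
  exact: le_trans h (clamp_lipschitz xy).
by move=> x; rewrite !massE// -EFinD -ab; congr EFin; ring.
Qed.

(** * Null fibers, with abstract coordinates [f] and [g] so that both margins are covered *)

Section null_fibers.
Context d (T : measurableType d) (R : realType).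
Variables (f g : {mfun T >-> R}) (h : R * R -> T).
Hypotheses (mh : measurable_fun setT h) (hK : forall p, h (f p, g p) = p).
Variables (mp mn : {finite_measure set T -> \bar R}) (Q : R -> R -> R).
Hypothesis mQ : forall x y,
  mass mp [set p | f p <= x /\ g p <= y] - mass mn [set p | f p <= x /\ g p <= y]
  = Q x y.
Hypothesis QP : forall x x' y, x <= x' ->
  0 <= Q x' y - Q x y <= clamp x' - clamp x.

Lemma measurable_mfun_ray (k : {mfun T >-> R}) y : measurable [set p | k p <= y].
Proof.
rewrite (_ : [set p | _] = k @^-1` `]-oo, y]).
  exact: measurable_preimage.
by apply/seteqP; split => p /=; rewrite in_itv.
Qed.

(** Once restricted to [g p <= y] and pushed along [f], [mp] and [mn] have distribution functions
    differing by [Q ^~ y]. *)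
Lemma eq_mass_null_rays E y : measurable E -> mass (unif01 R) E = 0 ->
  mass mp (f @^-1` E `&` [set p | g p <= y]) =
  mass mn (f @^-1` E `&` [set p | g p <= y]).
Proof.
move=> mE E0; have my := measurable_mfun_ray g y.
have := @eq_mass_null _ (Q ^~ y) (finite_push f (finite_restr mp my))
  (finite_push f (finite_restr mn my)) (fun x x' => @QP x x' y) _ E mE E0.
rewrite !mass_push !mass_restr; apply=> x; rewrite !mass_push !mass_restr -mQ.
by congr (mass _ _ - mass _ _); apply/seteqP; split => p /=; rewrite in_itv.
Qed.

(** For fixed [E] both sides are finite measures in [F], equal on rays by the previous lemma. *)
Lemma eq_mass_null_rectangles E F : measurable E -> measurable F ->
  mass (unif01 R) E = 0 ->
  mass mp (f @^-1` E `&` g @^-1` F) = mass mn (f @^-1` E `&` g @^-1` F).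
Proof.
move=> mE mF E0; have mfE := measurable_preimage f mE.
suff : finite_push g (finite_restr mp mfE) F = finite_push g (finite_restr mn mfE) F.
  move/(congr1 fine); rewrite -!/(mass _ _) !mass_push !mass_restr.
  by rewrite ![_ `&` f @^-1` _]setIC.
move: F mF; apply: finite_measure_unique_ray => x; rewrite !massE//; congr EFin.
rewrite !mass_push !mass_restr ![_ `&` f @^-1` _]setIC.
have := eq_mass_null_rays x mE E0.
by rewrite (_ : [set p | _] = g @^-1` `]-oo, x]).
Qed.

(** As [h] recovers a point from its coordinates, [A] is the preimage of a plane set, and plane
    measures are determined by rectangles. A rectangle [X] by [Y] meets the fiber over [E] above [E]
    and [X] together, again a null set. *)
Lemma eq_mass_null_fiber E A : measurable E -> measurable A ->
  mass (unif01 R) E = 0 ->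
  mass mp (f @^-1` E `&` A) = mass mn (f @^-1` E `&` A).
Proof.
move=> mE mA E0; have mfE := measurable_preimage f mE.
have mfg : measurable_fun setT (fun p => (f p, g p)).
  by apply: measurable_fun_pair; exact: measurable_funP.
pose fg : {mfun T >-> (R * R)%type} :=
  HB.pack (fun p => (f p, g p)) (isMeasurableFun.Build _ _ _ _ _ mfg).
have AE : A = fg @^-1` (h @^-1` A) by apply/seteqP; split => p /=; rewrite hK.
have mhA : measurable (h @^-1` A) by rewrite -[X in measurable X]setTI; exact: mh.
suff : finite_push fg (finite_restr mp mfE) (h @^-1` A) =
       finite_push fg (finite_restr mn mfE) (h @^-1` A).
  move/(congr1 fine); rewrite -!/(mass _ _) !mass_push !mass_restr -AE.
  by rewrite setIC.
move: (h @^-1` A) mhA.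
pose G : set (set (R * R)) := [set X `*` Y | X in measurable & Y in measurable].
apply: (measure_unique G (fun=> setT)) => //.
- exact: measurable_prod_measurableType.
- move=> _ _ [X1 mX1 [Y1 mY1 <-]] [X2 mX2 [Y2 mY2 <-]].
  exists (X1 `&` X2); first exact: measurableI.
  by exists (Y1 `&` Y2); [exact: measurableI|rewrite setXI].
- by move=> _; exists setT => //; exists setT => //; rewrite setXTT.
- by rewrite bigcup_const//; exists 0%N.
- move=> _ [X mX [Y mY <-]].
  have mXY : measurable (X `*` Y) by exact: measurableX.
  suff e : mass (finite_push fg (finite_restr mp mfE)) (X `*` Y) =
         mass (finite_push fg (finite_restr mn mfE)) (X `*` Y).
    apply: etrans (massE (finite_push fg (finite_restr mp mfE)) mXY) _.
    by rewrite e; exact/esym/massE.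
  rewrite !mass_push !mass_restr.
  have -> : fg @^-1` (X `*` Y) `&` f @^-1` E = f @^-1` (E `&` X) `&` g @^-1` Y.
    by apply/seteqP; split => p /= [[]].
  apply: eq_mass_null_rectangles => //; first exact: measurableI.
  apply/le_anti; rewrite mass_ge0 andbT -E0 le_mass//.
  exact: measurableI.
- by move=> _; exact: finite_measure_lty.
Qed.

(** Equal on the fiber but carried by [P] and [N] respectively, [mp] and [mn] must both vanish
    there. *)
Lemma null_fiber P N E : measurable P -> measurable N ->
  mass mp N = 0 -> mass mn P = 0 -> P `|` N = setT ->
  measurable E -> mass (unif01 R) E = 0 ->
  mass mp (f @^-1` E) = 0 /\ mass mn (f @^-1` E) = 0.
Proof.
move=> mP mN pN nP PN mE E0; have mfE := measurable_preimage f mE.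
have null0 (m : {finite_measure set T -> \bar R}) A B : measurable A ->
    measurable B -> mass m A = 0 -> mass m (B `&` A) = 0.
  move=> mA mB A0; apply/le_anti; rewrite mass_ge0 andbT -A0 le_mass//.
  exact: measurableI.
have split0 (m : {finite_measure set T -> \bar R}) :
    mass m (f @^-1` E `&` P) = 0 -> mass m (f @^-1` E `&` N) = 0 ->
    mass m (f @^-1` E) = 0.
  move=> m1 m2; rewrite -[f @^-1` E]setIT -PN setIUr.
  have mEP := measurableI _ _ mfE mP; have mEN := measurableI _ _ mfE mN.
  apply/le_anti; rewrite mass_ge0 andbT -lee_fin -massE; last exact: measurableU.
  have e0 : (m (f @^-1` E `&` P) + m (f @^-1` E `&` N) <= 0)%E.
    by rewrite !massE// m1 m2 adde0.
  by apply: le_trans (measureU2 _ _ _) e0.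
have e := @eq_mass_null_fiber E _ mE _ E0.
by split; apply: split0; [rewrite e//|..|rewrite -e//]; exact: null0.
Qed.

End null_fibers.

(** * Cutting a measure into thin slices *)

Section density.
Context d (T : measurableType d) (R : realType).
Implicit Types m : {finite_measure set T -> \bar R}.

Lemma integrable01 m (h : T -> R) : measurable_fun setT h ->
  (forall x, 0 <= h x <= 1) -> m.-integrable setT (EFin \o h).
Proof.
move=> mh h01; apply: measurable_bounded_integrable => //.
  exact: finite_measure_lty.
exists 1; split => // r r1 x _ /=; have /andP[h0 h1] := h01 x.
by rewrite ger0_norm// (le_trans h1)// ltW.
Qed.

Lemma finite_density m (h : T -> R) : measurable_fun setT h ->
  (forall x, 0 <= h x <= 1) ->
  exists m' : {finite_measure set T -> \bar R},
    forall A, measurable A -> m' A = (\int[m]_(x in A) (h x)%:E)%E.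
Proof.
move=> mh h01.
have [|m' m'E] := @finite_measure_of_charge _ _ _ (induced_charge (integrable01 m mh h01)).
  move=> A mA; apply: integral_ge0 => x _.
  by rewrite lee_fin; case/andP: (h01 x).
by exists m'.
Qed.

(** The truncations [H j], the minimum of [1] and [s j * G], increase from [0] to [1]. The slice
    [tau j] has density [H j.+1 - H j], and the remainder [rho j] has density [1 - H j]; the
    remainders vanish by dominated convergence. *)
Lemma slicing m (G : T -> R) (s : nat -> R) : measurable_fun setT G ->
  (forall x, 0 < G x) -> s 0%N = 0 -> (forall j, s j <= s j.+1) ->
  s n @[n --> \oo] --> +oo ->
  exists tau rho : nat -> {finite_measure set T -> \bar R},
    [/\ forall A, measurable A -> mass (rho 0%N) A = mass m A,
        forall j A, measurable A ->
          mass (rho j) A = mass (tau j) A + mass (rho j.+1) A,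
        mass (rho j) setT @[j --> \oo] --> 0 &
        forall j A, measurable A ->
          (tau j A <= (s j.+1 - s j)%:E * \int[m]_(x in A) (G x)%:E)%E].
Proof.
move=> mG G0 s0 sS soo.
have s_ge0 j : 0 <= s j by elim: j => [|j ih]; [rewrite s0|exact: le_trans (sS j)].
pose H j x := Num.min 1 (s j * G x).
have mH j : measurable_fun setT (H j).
  by apply: measurable_minr => //; exact: measurable_funM.
have H01 j x : 0 <= H j x <= 1.
  by rewrite /H le_min ler01/= ge_min lexx mulr_ge0// ltW.
have HS j x : H j x <= H j.+1 x.
  by rewrite /H le_min ge_min lexx/= ge_min ler_wpM2r ?orbT// ltW.
have Hlip j x : H j.+1 x - H j x <= (s j.+1 - s j) * G x.
  have := ler_wpM2r (ltW (G0 x)) (sS j); rewrite /H mulrBl.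
  by case: (leP 1 (s j * G x)); case: (leP 1 (s j.+1 * G x)) => *; lra.
have /choice[tau tauE] : forall j, exists t : {finite_measure set T -> \bar R},
    forall A, measurable A ->
      t A = (\int[m]_(x in A) (H j.+1 x - H j x)%:E)%E.
  move=> j; apply: finite_density; first exact: measurable_funB.
  move=> x; rewrite subr_ge0 HS/= lerBlDr (le_trans (andP (H01 j.+1 x)).2)//.
  by rewrite lerDl; case/andP: (H01 j x).
have /choice[rho rhoE] : forall j, exists t : {finite_measure set T -> \bar R},
    forall A, measurable A -> t A = (\int[m]_(x in A) (1 - H j x)%:E)%E.
  move=> j; apply: finite_density; first exact: measurable_funB.
  by move=> x; have /andP[? ?] := H01 j x; apply/andP; split; lra.
have mB (f g : T -> R) A : measurable_fun setT f -> measurable_fun setT g ->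
    measurable_fun A (fun x => (f x - g x)%:E).
  by move=> mf mg; apply: measurable_funTS; apply/measurable_EFinP; exact: measurable_funB.
exists tau, rho; split.
- move=> A mA; rewrite /mass rhoE//; congr fine.
  rewrite -[RHS]mul1e -integral_cst//; apply: eq_integral => x _.
  by rewrite /H s0 mul0r min_r// subr0.
- move=> j A mA; apply: EFin_inj; rewrite EFinD -!massE// rhoE// tauE// rhoE//.
  rewrite -ge0_integralD//.
  + by apply: eq_integral => x _; rewrite -EFinD; congr EFin; ring.
  + by move=> x _; rewrite lee_fin subr_ge0.
  + exact: mB.
  + by move=> x _; rewrite lee_fin subr_ge0; case/andP: (H01 j.+1 x).
  + exact: mB.
- have [|||_ _] := @dominated_convergence _ T R m setT measurableT
    (fun j x => (1 - H j x)%:E) (cst 0%E) (cst 1%E)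
    (fun j => mB (cst 1) (H j) setT (measurable_cst _) (mH j)) (measurable_cst _).
  + apply: aeW => x _; apply: cvg_near_cst.
    (* Once [s n] exceeds the inverse of [G x] the truncation is active and the density of the
       remainder at [x] is exactly [0]. *)
    have : \forall n \near \oo, (G x)^-1 <= s n.
      exact: (cvgryPge _).1 soo _.
    apply: filterS => n sG; rewrite /H min_l ?subrr//.
    by rewrite -(mulVf (lt0r_neq0 (G0 x))) ler_wpM2r// ltW.
  + by apply: (integrable01 m (h := cst 1)) => // x; rewrite /= ler01 lexx.
  + apply: aeW => x j _ /=; rewrite lee_fin; have /andP[? ?] := H01 j x.
    by rewrite ger0_norm; lra.
  + rewrite integral_cst//= mul0e => /fine_cvg; apply: cvg_trans.
    by apply: near_eq_cvg; apply: nearW => j; rewrite /mass rhoE.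
- move=> j A mA; rewrite tauE// -ge0_integralZl//.
  + apply: ge0_le_integral => //.
    * by move=> x _; rewrite lee_fin subr_ge0.
    * exact: mB.
    * apply: measurable_funTS; apply/measurable_EFinP.
      exact: measurable_funM.
    * by move=> x _; rewrite lee_fin Hlip.
  + by apply: measurable_funTS; exact/measurable_EFinP.
  + by move=> x _; rewrite lee_fin ltW.
  + by rewrite lee_fin subr_ge0.
Qed.

End density.

(** If [f] is the Radon-Nikodym density of [m], weighting [m] by [expR (- f)] turns the density into
    [f * expR (- f)], at most [1]. Positivity is what [slicing] asks of its weight; the bound [1]
    allows weights to be multiplied. *)
Lemma weight_exists (R : realType) (m : {finite_measure set R -> \bar R}) :
  (forall E, measurable E -> mass (unif01 R) E = 0 -> mass m E = 0) ->
  exists g : R -> R, [/\ measurable_fun setT g, forall x, 0 < g x <= 1 &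
    forall E, measurable E ->
      (\int[m]_(x in E) (g x)%:E <= (mass (unif01 R) E)%:E)%E].
Proof.
move=> m0.
have mu : m `<< unif01 R.
  apply/null_content_dominatesP => E mE uE.
  by apply: etrans (massE m mE) _; rewrite m0// /mass uE.
pose f := Radon_Nikodym_SigmaFinite.f m (unif01 R).
have f0 := Radon_Nikodym_SigmaFinite.f_ge0 mu.
have ff := Radon_Nikodym_SigmaFinite.f_fin_num mu.
have mf : measurable_fun setT f.
  exact: measurable_int (Radon_Nikodym_SigmaFinite.f_integrable mu).
pose fr x := fine (f x).
have fr0 x : 0 <= fr x by exact: fine_ge0.
have mfr : measurable_fun setT fr by exact: measurableT_comp.
(* [u * expR (- u) <= 1] and [0 < expR (- u) <= 1] for [0 <= u] *)
pose g x := expR (- fr x).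
have g0 x : 0 < g x := expR_gt0 _.
have mg : measurable_fun setT g.
  by apply: measurableT_comp => //; exact: measurableT_comp.
exists g; split => //.
  by move=> x; rewrite g0/= -expR0 ler_expR oppr_le0.
move=> E mE.
rewrite -(Radon_Nikodym_SigmaFinite.change_of_variables mu)//; last 2 first.
- by move=> x; rewrite lee_fin ltW.
- by apply: measurable_funTS; exact/measurable_EFinP.
rewrite -massE// -[leRHS]mul1e -integral_cst//.
apply: ge0_le_integral => //.
- by move=> x _; rewrite mule_ge0// lee_fin ltW.
- apply: emeasurable_funM; last exact: measurable_funTS.
  by apply: measurable_funTS; exact/measurable_EFinP.
- move=> x _; have fE : f x = (fr x)%:E by exact/esym/fineK/ff.
  rewrite -/f fE -EFinM lee_fin /= /g.
  rewrite expRN mulrC ler_pdivrMr ?expR_gt0// mul1r.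
  by apply: le_trans (expR_ge1Dx _); rewrite lerDr.
Qed.

(** * Approximation by linear combinations of copulas *)

Section total_variation_bounds.
Context d (T : measurableType d) (R : realType).
Implicit Types nu : {charge set T -> \bar R}.

Lemma le_tv_norm nu A : measurable A -> (`|nu A| <= tv_norm nu)%E.
Proof.
move=> mA; have [P [N nuPN]] := Hahn_decomposition nu.
rewrite (tv_normE nuPN); apply: le_trans (abse_charge_variation nuPN mA) _.
by rewrite /charge_variation; apply: leeD; apply: le_measure; rewrite ?inE.
Qed.

(** The norm is [nu P - nu N] for a Hahn decomposition; each term costs one [b]. *)
Lemma tv_norm_le nu (b : R) : (forall A, measurable A -> (`|nu A| <= b%:E)%E) ->
  (tv_norm nu <= (2 * b)%:E)%E.
Proof.
move=> nub; have [P [N nuPN]] := Hahn_decomposition nu.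
have [[mP _] [mN _] _ _] := nuPN.
rewrite (tv_normE nuPN) jordan_posE jordan_negE cjordan_posE cjordan_negE.
rewrite /crestr0 !mem_set// /crestr !setTI mulr_natl mulr2n EFinD.
apply: leeD; first exact: le_trans (lee_abs _) (nub _ mP).
by apply: le_trans (nub _ mN); rewrite -abseN lee_abs.
Qed.

Lemma charge_seriesE (gamma : nat -> R) (m : nat -> {finite_measure set T -> \bar R})
    n A : measurable A ->
  charge_series (fun k => cscale (gamma k) (charge_of_finite_measure (m k))) n A =
  (\sum_(k < n) gamma k * mass (m k) A)%:E.
Proof.
move=> mA; elim: n => [|n ih]; first by rewrite big_ord0.
rewrite big_ord_recr EFinD EFinM -massE//= /cadd.
by congr (_ + _)%E.
Qed.

End total_variation_bounds.

Lemma integral_finite_push d1 d2 (T1 : measurableType d1) (T2 : measurableType d2)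
    (R : realType) (f : {mfun T1 >-> T2}) (m : {finite_measure set T1 -> \bar R})
    (k : T2 -> \bar R) E : measurable E -> measurable_fun setT k ->
  (forall y, (0 <= k y)%E) ->
  (\int[finite_push f m]_(y in E) k y = \int[m]_(x in f @^-1` E) k (f x))%E.
Proof.
move=> mE mk k0.
rewrite -(@ge0_integral_pushforward _ _ _ _ _ f (measurable_funPT f) m E k)//.
- by apply: eq_measure_integral => A mA _; exact: finite_ofE.
- exact: measurable_funTS.
Qed.

(** Additivity with the zero measure [z] writes both sides as [centered t' A + centered z A]. *)
Lemma eq_centered (R : realType) (t t' : {finite_measure set (borel_square R) -> \bar R}) :
  (forall A, measurable A -> mass t A = mass t' A) ->
  forall A, measurable A -> centered t A = centered t' A.
Proof.
move=> tt' A mA; pose z := finite_restr t measurable0.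
have z0 B : mass z B = 0 by rewrite mass_restr setI0 mass0.
have h1 : centered t A = centered t' A + centered z A.
  by apply: centeredD mA => B mB; rewrite z0 addr0 tt'.
have h2 : centered t' A = centered t' A + centered z A.
  by apply: centeredD mA => B mB; rewrite z0 addr0.
by rewrite h1 -h2.
Qed.

Section approximation.
Context (R : realType) (Q : R -> R -> R) (hQ : quasi_copula Q).
Notation fmS := {finite_measure set (borel_square R) -> \bar R}.
Variables (mp mn : fmS) (P N : set (borel_square R)).
Hypotheses (mP : measurable P) (mN : measurable N) (PN : P `|` N = setT).
Hypotheses (mpN : mass mp N = 0) (mnP : mass mn P = 0).
Hypothesis mQ : forall x y, x \in `[0, 1] -> y \in `[0, 1] ->
  mass mp (box x y) - mass mn (box x y) = Q x y.

(** With a negative coordinate the box is empty, and [Q] vanishes because it is grounded. *)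
Lemma mass_box_clamp x y :
  mass mp (box x y) - mass mn (box x y) = Q (clamp x) (clamp y).
Proof.
have [_ Q0 _ _ _] := hQ; have c01 := @clamp_in01 R.
rewrite !(box_clamp x y); case: ifPn => [_|]; first exact: mQ.
rewrite !mass0 subr0 negb_and -!ltNge => /orP[] /ltW /clamp_le0 ->.
  by case: (Q0 _ (c01 y)).
by case: (Q0 _ (c01 x)).
Qed.

Lemma quasi_copula_clamp x x' y : x <= x' ->
  0 <= Q (clamp x') (clamp y) - Q (clamp x) (clamp y) <= clamp x' - clamp x /\
  0 <= Q (clamp y) (clamp x') - Q (clamp y) (clamp x) <= clamp x' - clamp x.
Proof.
move=> /clamp_mono xx'; have [_ _ _ Qmono Qlip] := hQ; have c01 := @clamp_in01 R.
have [m1 m2] := Qmono _ _ _ (c01 x) (c01 x') (c01 y) xx'.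
rewrite !subr_ge0 m1 m2/=; split; apply: le_trans (ler_norm _) _.
  apply: le_trans (Qlip _ _ _ _ (c01 x) (c01 y) (c01 x') (c01 y)) _.
  by rewrite subrr normr0 addr0 ger0_norm ?subr_ge0.
apply: le_trans (Qlip _ _ _ _ (c01 y) (c01 x) (c01 y) (c01 x')) _.
by rewrite subrr normr0 add0r ger0_norm ?subr_ge0.
Qed.

Lemma null_marg1 E : measurable E -> mass (unif01 R) E = 0 ->
  mass (marg1 mp) E = 0 /\ mass (marg1 mn) E = 0.
Proof.
move=> mE E0; rewrite !mass_marg1.
apply: (@null_fiber _ _ _ (@sqfst R) (@sqsnd R) (@to_sq R) (@measurable_to_sq R)
  (@to_sqK R) mp mn (fun x y => Q (clamp x) (clamp y)) _ _ P N E) => //.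
- by move=> x y; rewrite -mass_box_clamp boxE.
- by move=> x x' y xx'; case: (quasi_copula_clamp y xx').
Qed.

Lemma null_marg2 E : measurable E -> mass (unif01 R) E = 0 ->
  mass (marg2 mp) E = 0 /\ mass (marg2 mn) E = 0.
Proof.
move=> mE E0; rewrite !mass_marg2.
(* The coordinates are exchanged here, so points are rebuilt after a swap. *)
have mswap : measurable_fun setT (fun z : R * R => @to_sq R (z.2, z.1)).
  apply: measurableT_comp; first exact: measurable_to_sq.
  by apply: measurable_fun_pair.
apply: (@null_fiber _ _ _ (@sqsnd R) (@sqfst R) _ mswap _
  mp mn (fun x y => Q (clamp y) (clamp x)) _ _ P N E) => //.
- exact: to_sqK.
- move=> x y; rewrite -mass_box_clamp.
  suff -> : box y x = [set p | sqsnd p <= x /\ sqfst p <= y] by [].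
  by rewrite boxE; apply/seteqP; split => p [].
- by move=> x x' y xx'; case: (quasi_copula_clamp y xx').
Qed.

(** The error bound [r j] does not depend on [A]; it therefore controls both the functions on boxes
    and the total variation. *)
Lemma copula_slices : exists (alpha beta : nat -> fmS) (r : nat -> R),
  [/\ forall j, copula (fun x y => mass (alpha j) (box x y)),
      forall j, copula (fun x y => mass (beta j) (box x y)),
      r j @[j --> \oo] --> 0 &
      forall j A, measurable A ->
        `|mass (unif_sq R) A
          + \sum_(i < j) 2 * i.+1%:R^-1 * (mass (alpha i) A - mass (beta i) A)
          - (mass mp A - mass mn A)| <= r j].
Proof.
have [f1 [mf1 f1P f1I]] := weight_exists (fun E mE E0 => (null_marg1 mE E0).1).
have [f2 [mf2 f2P f2I]] := weight_exists (fun E mE E0 => (null_marg1 mE E0).2).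
have [g1 [mg1 g1P g1I]] := weight_exists (fun E mE E0 => (null_marg2 mE E0).1).
have [g2 [mg2 g2P g2I]] := weight_exists (fun E mE E0 => (null_marg2 mE E0).2).
(* The four weights belong to the two margins of [mp] and of [mn]. Since all are at most [1], their
   product lies below each and serves all margins at once. *)
pose G (p : borel_square R) :=
  f1 (sqfst p) * f2 (sqfst p) * (g1 (sqsnd p) * g2 (sqsnd p)).
have mulle (a b : R) : 0 < a <= 1 -> 0 < b <= 1 ->
    [/\ 0 < a * b <= 1, a * b <= a & a * b <= b].
  move=> /andP[a0 a1] /andP[b0 b1].
  have h1 : a * b <= a by rewrite -[leRHS]mulr1 ler_wpM2l// ltW.
  have h2 : a * b <= b by rewrite -[leRHS]mul1r ler_wpM2r// ltW.
  by split => //; rewrite mulr_gt0// (le_trans h1).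
have GP p : [/\ 0 < G p, G p <= f1 (sqfst p), G p <= f2 (sqfst p),
    G p <= g1 (sqsnd p) & G p <= g2 (sqsnd p)].
  have [f12 f121 f122] := mulle _ _ (f1P (sqfst p)) (f2P (sqfst p)).
  have [g12 g121 g122] := mulle _ _ (g1P (sqsnd p)) (g2P (sqsnd p)).
  have [/andP[? _] h1 h2] := mulle _ _ f12 g12.
  by split => //; [exact: le_trans f121|exact: le_trans f122
                  |exact: le_trans g121|exact: le_trans g122].
have mG : measurable_fun setT G.
  by do 2 apply: measurable_funM; apply: measurableT_comp => //; exact: measurable_funP.
(* Divergence of the series exhausts the measures, while its vanishing terms make the coefficients
   of the copulas tend to [0]. *)
pose s : nat -> R := series harmonic.
have sS j : s j.+1 - s j = j.+1%:R^-1.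
  by rewrite /s /series/= big_nat_recr//= addrAC subrr add0r.
have s0 : s 0%N = 0 by rewrite /s /series/= big_geq.
have snd j : s j <= s j.+1 by rewrite -subr_ge0 sS invr_ge0.
have soo : s n @[n --> \oo] --> +oo.
  apply: nondecreasing_dvgn_lt; last exact: dvg_harmonic.
  exact/nondecreasing_seqP.
have G0 p : 0 < G p by case: (GP p).
have [taup [rhop [rhop0 rhopS rhop_cvg taup_le]]] := slicing mp mG G0 s0 snd soo.
have [taun [rhon [rhon0 rhonS rhon_cvg taun_le]]] := slicing mn mG G0 s0 snd soo.
(* Replacing [G] by the larger weight [k] of a single coordinate turns the integral into one against
   the margin, bounded by the choice of [k]. *)
have marg_le (t m : fmS) (pr : {mfun borel_square R >-> R}) (k : R -> R) j :
    measurable_fun setT k -> (forall x, 0 < k x <= 1) ->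
    (forall p, G p <= k (pr p)) ->
    (forall E, measurable E ->
      (\int[finite_push pr m]_(x in E) (k x)%:E <= (mass (unif01 R) E)%:E)%E) ->
    (forall A, measurable A ->
      (t A <= (s j.+1 - s j)%:E * \int[m]_(x in A) (G x)%:E)%E) ->
    forall A, measurable A ->
      mass (finite_push pr t) A <= j.+1%:R^-1 * mass (unif01 R) A.
  move=> mk kP Gk kI tG A mA; have mprA := measurable_preimage pr mA.
  rewrite mass_push -lee_fin -massE//; apply: le_trans (tG _ mprA) _.
  rewrite sS EFinM lee_wpmul2l ?lee_fin ?invr_ge0//.
  apply: le_trans (kI _ mA); rewrite integral_finite_push//; last 2 first.
    exact/measurable_EFinP.
    by move=> y; rewrite lee_fin ltW//; case/andP: (kP y).
  apply: ge0_le_integral => //.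
  - by move=> x _; rewrite lee_fin ltW.
  - by apply: measurable_funTS; exact/measurable_EFinP.
  - apply: measurable_funTS; apply/measurable_EFinP.
    by apply: measurableT_comp => //; exact: measurable_funP.
  - by move=> x _; rewrite lee_fin.
have a0 j : 0 < j.+1%:R^-1 :> R by rewrite invr_gt0.
have /choice[alpha alphaP] j := centered_copula (t := taup j) (a0 j)
  (marg_le _ _ _ _ _ mf1 f1P (fun p => let: And5 _ h _ _ _ := GP p in h) f1I (taup_le j))
  (marg_le _ _ _ _ _ mg1 g1P (fun p => let: And5 _ _ _ h _ := GP p in h) g1I (taup_le j)).
have /choice[beta betaP] j := centered_copula (t := taun j) (a0 j)
  (marg_le _ _ _ _ _ mf2 f2P (fun p => let: And5 _ _ h _ _ := GP p in h) f2I (taun_le j))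
  (marg_le _ _ _ _ _ mg2 g2P (fun p => let: And5 _ _ _ _ h := GP p in h) g2I (taun_le j)).
(* [centered_bound] applied to the two remainders. *)
exists alpha, beta, (fun j => 2 * mass (rhop j) setT + 2 * mass (rhon j) setT).
split; [by move=> j; case: (alphaP j)|by move=> j; case: (betaP j)| |].
  rewrite -[X in _ --> X](addr0 0) -[X in _ --> X + _](mulr0 2).
  rewrite -[X in _ --> _ + X](mulr0 2).
  by apply: cvgD; apply: cvgMr => //; exact: cvg_cst.
move=> j A mA.
have [_ _ Q1 _ _] := hQ.
have cmu : centered mp A - centered mn A = mass mp A - mass mn A - mass (unif_sq R) A.
  apply: centered_jordan => // x x01; rewrite mQ ?one01//; first by case: (Q1 _ x01).
  by case: (Q1 _ x01).
(* The multiples of [unif_sq] in the formulas for [alpha i] and [beta i] cancel in the difference,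
   leaving the centered slices. *)
have tele : centered mp A - centered mn A =
    \sum_(i < j) 2 * i.+1%:R^-1 * (mass (alpha i) A - mass (beta i) A)
    + centered (rhop j) A - centered (rhon j) A.
  elim: j => [|j ->].
    rewrite big_ord0 add0r.
    by rewrite (eq_centered rhop0 mA) (eq_centered rhon0 mA).
  rewrite big_ord_recr/=.
  rewrite (centeredD (rhopS j) mA) (centeredD (rhonS j) mA) mulrBr.
  have [_ /(_ _ mA) ->] := alphaP j; have [_ /(_ _ mA) ->] := betaP j.
  by ring.
have bp := centered_bound (rhop j) mA; have bn := centered_bound (rhon j) mA.
rewrite (_ : _ - _ = centered (rhon j) A - centered (rhop j) A); last by lra.
by apply: le_trans (ler_normB _ _) _; rewrite addrC lerD.
Qed.

End approximation.

Lemma uniform_cvg_bound (R : realType) (f : nat -> R * R -> R) (g : R * R -> R)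
    (b : nat -> R) (A : set (R * R)) :
  b n @[n --> \oo] --> 0 ->
  (forall n p, A p -> `|f n p - g p| <= b n) ->
  {uniform A, f @ \oo --> g}.
Proof.
move=> b0 fb U /uniform_nbhs[E [+ EU]]; rewrite -entourage_ballE => -[e /= e0 eE].
have : \forall n \near \oo, b n < e by exact: cvgr_lt b0 _ e0.
apply: filterS => n bn; apply: EU => p Ap; apply: eE.
by rewrite /ball/= distrC (le_lt_trans (fb n p Ap)).
Qed.

Lemma uniform_cvg_pointwise (R : realType) (f : nat -> R * R -> R) (g : R * R -> R)
    (A : set (R * R)) p : A p -> {uniform A, f @ \oo --> g} ->
  f n p @[n --> \oo] --> g p.
Proof.
move=> Ap fg; apply/cvgrPdist_lt => e e0.
have : nbhs (g : {uniform` A -> R}) [set h | forall y, A y -> ball (g y) e (h y)].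
  apply/uniform_nbhs; exists [set xy | ball xy.1 e xy.2]; split => //.
  by rewrite -entourage_ballE; exists e.
move=> /fg h; near=> n.
suff fgn : forall y, A y -> ball (g y) e (f n y) by exact: fgn.
by near: n; exact: h.
Unshelve. all: by end_near. Qed.

Theorem theorem1 (R : realType) (Q : R -> R -> R) (hQ : quasi_copula Q) :
  (exists muQ : {charge set (borel_square R) -> \bar R}, induces Q muQ)
  <->
  (exists (C : nat -> R -> R -> R) (gamma : nat -> R),
     [/\ (forall n, copula (C n)),
         {uniform @unit_square R,
            (fun n (p : R * R) => \sum_(k < n) gamma k * C k p.1 p.2) @ \oo
            --> (fun p : R * R => Q p.1 p.2)} &
         exists mu : nat -> {finite_measure set (borel_square R) -> \bar R},
           (forall n, induces (C n) (mu n)) /\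
           exists nu : {charge set (borel_square R) -> \bar R},
             tv_cvg (charge_series
                       (fun n => cscale (gamma n)
                                   (charge_of_finite_measure (mu n)))) nu]).
Proof.
split; last first.
  move=> [C [gamma [_ CQ [mu [Cmu [nu munu]]]]]].
  (* The limit charge itself induces [Q]: on a box the partial sums tend to [Q x y] by uniform
     convergence and to [nu B] because the norm dominates evaluation on [B]. *)
  exists nu => x y x01 y01.
  have mB := measurable_box x y; set B := box x y in mB *.
  pose u n := \sum_(k < n) gamma k * C k x y.
  have uQ : u n @[n --> \oo] --> Q x y.
    have xy : unit_square (x, y) by split.
    exact: (uniform_cvg_pointwise xy CQ).
  have nuB : nu B \is a fin_num by exact: fin_num_measure.
  suff unu : u n @[n --> \oo] --> fine (nu B).
    by rewrite -(fineK nuB) (cvg_unique _ uQ unu).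
  have uE n : (u n)%:E = charge_series (fun n => cscale (gamma n)
      (charge_of_finite_measure (mu n))) n B.
    rewrite charge_seriesE//; congr EFin; apply: eq_bigr => k _.
    by rewrite /mass Cmu.
  (* The norms are eventually finite, so passing to real values loses nothing. *)
  have /fine_cvgP[tvfin /cvgrPdist_lt tv0] := munu.
  apply/cvgrPdist_lt => e e0; near=> n.
  have tvn : `|0 - fine (tv_norm (cadd (charge_series (fun n => cscale (gamma n)
      (charge_of_finite_measure (mu n))) n) (copp nu)))| < e.
    by near: n; exact: tv0.
  rewrite sub0r normrN in tvn; apply: le_lt_trans (le_lt_trans (ler_norm _) tvn).
  rewrite -lee_fin fineK; last by near: n.
  apply: le_trans (le_tv_norm _ mB).
  rewrite [X in (_ <= `|X|)%E](_ : _ = (u n - fine (nu B))%:E).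
    by rewrite abse_EFin distrC.
  by rewrite EFinB uE fineK.
move=> [muQ QmuQ].
have [P [N muPN]] := Hahn_decomposition muQ.
have [[mP _] [mN _] PN PN0] := muPN.
pose mp : {finite_measure set _ -> \bar R} := jordan_pos muPN.
pose mn : {finite_measure set _ -> \bar R} := jordan_neg muPN.
have mpE A : measurable A -> mass mp A = fine (muQ (A `&` P)).
  by move=> mA; rewrite /mass /= jordan_posE cjordan_posE /crestr0 mem_set.
have mnE A : measurable A -> mass mn A = - fine (muQ (A `&` N)).
  move=> mA; rewrite /mass /= jordan_negE cjordan_negE /crestr0 mem_set// fineN.
  by [].
have muE A : measurable A -> muQ A = (mass mp A - mass mn A)%:E.
  move=> mA; rewrite mpE// mnE// opprK EFinD !fineK ?fin_num_measure//;
    try exact: measurableI.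
  by rewrite -(charge_partition muQ _ mP mN).
have mpN : mass mp N = 0 by rewrite mpE// setIC PN0 charge0.
have mnP : mass mn P = 0 by rewrite mnE// PN0 charge0 oppr0.
have mQ x y : x \in `[0, 1] -> y \in `[0, 1] ->
    mass mp (box x y) - mass mn (box x y) = Q x y.
  move=> x01 y01; apply: EFin_inj; rewrite -muE; last exact: measurable_box.
  exact: QmuQ.
have [alpha [beta [r [aC bC r0 rP]]]] := copula_slices hQ mP mN PN mpN mnP mQ.
(* The order is [unif_sq], [alpha 0], [beta 0], [alpha 1], [beta 1], and so on, with coefficients
   [1], [2], [- 2], [2 / 2], [- 2 / 2], and so on. *)
pose m n := if n is k.+1 then (if odd k then beta k./2 else alpha k./2)
            else unif_sq R.
pose gamma n : R := if n is k.+1 then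
  (if odd k then - (2 * (k./2).+1%:R^-1) else 2 * (k./2).+1%:R^-1) else 1.
(* The second term pays for a partial sum stopping between [alpha j] and [beta j]. *)
pose c j : R := r j + 2 * j.+1%:R^-1.
have c0 : c j @[j --> \oo] --> 0.
  rewrite -[X in _ --> X](addr0 0) -[X in _ --> _ + X](mulr0 2).
  apply: cvgD => //; apply: cvgMr => //; exact: cvg_harmonic.
(* The value at [0] bounds the error of the empty sum. *)
pose b n := if n is k.+1 then c k./2 else mass mp setT + mass mn setT.
have b0 : b n @[n --> \oo] --> 0.
  apply/cvgrPdist_lt => e e0; have /cvgrPdist_lt/(_ _ e0)[M _ cM] := c0.
  exists M.*2.+1 => // -[|k]//= Mk; apply: cM => /=.
  by rewrite -(doubleK M) half_leq.
have alphaT j : mass (alpha j) setT = 1.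
  by have [_ _ /(_ _ (one01 R))[+ _] _] := aC j; rewrite box11.
(* Sums of [2 j + 1] terms contain [unif_sq] and [j] complete pairs. *)
have even_sum j A :
    \sum_(k < j.*2.+1) gamma k * mass (m k) A =
    mass (unif_sq R) A
    + \sum_(i < j) 2 * i.+1%:R^-1 * (mass (alpha i) A - mass (beta i) A).
  elim: j => [|j ih]; first by rewrite big_ord_recr !big_ord0/= mul1r add0r addr0.
  rewrite doubleS big_ord_recr/= big_ord_recr/= ih big_ord_recr/=.
  rewrite odd_double/= uphalf_double doubleK.
  by ring.
have boundP n A : measurable A ->
    `|\sum_(k < n) gamma k * mass (m k) A - (mass mp A - mass mn A)| <= b n.
  move=> mA; case: n => [|n].
    rewrite big_ord0 sub0r normrN; apply: le_trans (ler_normB _ _) _.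
    by rewrite !ger0_norm ?mass_ge0// lerD// le_mass.
  rewrite /b /c -[n in X in `|X|]odd_double_half; have rA := rP n./2 A mA.
  (* For odd [n], the [n.+1] terms end with an unpaired [alpha], whose total mass is [1]; for even
     [n] all pairs are complete. *)
  case: (odd n) => /=; rewrite ?add0n ?add1n.
    rewrite big_ord_recr/= even_sum odd_double/= doubleK addrAC.
    apply: le_trans (ler_normD _ _) _; apply: lerD => //.
    rewrite normrM ger0_norm ?mulr_ge0 ?invr_ge0// -[leRHS]mulr1.
    rewrite ler_wpM2l ?mulr_ge0 ?invr_ge0// ger0_norm ?mass_ge0//.
    by rewrite -(alphaT n./2) le_mass.
  by rewrite even_sum; apply: le_trans rA _; rewrite lerDl mulr_ge0 ?invr_ge0.
exists (fun n x y => mass (m n) (box x y)), gamma; split.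
- by case=> [|n] /=; [exact: copula_unif_sq|case: odd].
- apply: (uniform_cvg_bound b0) => n [x y] [/= x01 y01].
  by rewrite -mQ// boundP//; exact: measurable_box.
- exists m; split; first by move=> n x y _ _; rewrite massE//; exact: measurable_box.
  exists muQ; rewrite /tv_cvg.
  have b2 : (2 * b n)%:E @[n --> \oo] --> (0%:E : \bar R).
    apply: cvg_EFin; first exact: nearW.
    by rewrite -[X in _ --> X](mulr0 2); apply: cvgMr => //; exact: cvg_cst.
  apply: (squeeze_cvge _ (cvg_cst 0%E) b2); apply: nearW => n.
  apply/andP; split.
    exact: le_trans (abse_ge0 _) (le_tv_norm _ measurable0).
  (* The bound [boundP], used on boxes for uniform convergence, here serves on all Borel sets. *)
  apply: tv_norm_le => A mA.
  rewrite [X in (`|X| <= _)%E](_ : _ = (\sum_(k < n) gamma k * mass (m k) A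
      - (mass mp A - mass mn A))%:E); first by rewrite abse_EFin lee_fin boundP.
  by rewrite EFinB -charge_seriesE// -muE.
Unshelve. all: by end_near. Qed.
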